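(* Let $V$ be a finite set and let $B,B'\subseteq V$ satisfy $B\cap B'=\emptyset$. Let $w_i=0$ for $i\in V\setminus(B\cup B')$. Then, for any $J_{B\cup\{j\}}\in\mathbb{R}$, $j\in B'$, and any $\epsilon>0$, there is a choice of $w_{B\cup B'}=(w_i)_{i\in B\cup B'}\in\mathbb{R}^{B\cup B'}$ and $c\in\mathbb{R}$ such that $|K_{B\cup\{j\}}(w,c)-J_{B\cup\{j\}}|\le\epsilon$ for all $j\in B'$, and $|K_C(w,c)|\le\epsilon$ for all $C\subseteq V$ with $C\ne B$ and $C\neq B\cup\{j\}$ for every $j\in B'$.
   Context: For $w=(w_i)_{i\in V}\in\mathbb{R}^V$ and $c\in\mathbb{R}$, the soft-plus unit is the function $\phi:\{0,1\}^V\to\mathbb{R}$, $\phi(x)=\log(1+\exp(\sum_{i\in V}w_ix_i+c))$. Its coefficients as a polynomial $\phi(x)=\sum_{C\subseteq V}K_C\prod_{i\in C}x_i$ on $\{0,1\}^V$ are $$K_C(w,c)=\sum_{A\subseteq C}(-1)^{|C\setminus A|}\log\Big(1+\exp\Big(\sum_{i\in A}w_i+c\Big)\Big),\quad C\subseteq V.$$ *)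

(* Defs.v *)
From HB Require Import structures.
From mathcomp Require Import all_boot all_order all_algebra.
From mathcomp Require Import reals sequences exp.

Set Implicit Arguments.
Unset Strict Implicit.
Unset Printing Implicit Defensive.

Import Order.TTheory GRing.Theory Num.Theory.
Local Open Scope ring_scope.

(* A binary vector x in {0,1}^V is represented by its support {i | x_i = 1}. *)
Definition softplus (R : realType) (V : finType) (w : V -> R) (c : R)
    (x : {set V}) : R :=
  ln (1 + expR (\sum_(i in x) w i + c)).

(* By Moebius inversion, softplus w c x = \sum_(C : {set V} | C \subset x)
   softplus_coef w c C: these are the coefficients of the soft-plus unit in
   the basis of square-free monomials \prod_(i in C) x_i. *)
Definition softplus_coef (R : realType) (V : finType) (w : V -> R) (c : R)
    (C : {set V}) : R :=
  \sum_(A : {set V} | A \subset C) (-1) ^+ #|C :\: A| * softplus w c A.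

(* Main.v *)
Require Import Defs.
From HB Require Import structures.
From mathcomp Require Import all_boot all_order all_algebra.
From mathcomp Require Import reals sequences exp.
From mathcomp Require Import lra.

Set Implicit Arguments.
Unset Strict Implicit.
Unset Printing Implicit Defensive.

Import Order.TTheory GRing.Theory Num.Theory.
Local Open Scope ring_scope.

(** The coefficients K_C are the Moebius transform of the values of the unit on
    subsets of V, so it suffices to make these values uniformly close to a
    function whose Moebius transform is the wanted one: a free value at B,
    a j := J (B :|: [set j]) at B :|: [set j], and 0 elsewhere.  As the upset
    indicator of D has Moebius transform the indicator of D
    ([moebius_upset]), this target is

      A |-> K + (sum of a j over j in A and B')  if B is contained in A,
      A |-> 0                                     otherwise.

    This function is a rectified linear unit.  Give the elements of B the large
    weight 2 K, those of B' the weight a j, and choose the bias such that the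
    preactivation is K + O(1) when A contains B and drops by 2 K for each
    missing element of B.  It is then at most - K + O(1) when A misses part
    of B, so the sign of the preactivation detects whether B is contained in A,
    and its positive part is the target ([gate_relu]).

    For large K all preactivations are far from 0, where log (1 + exp t) and
    Num.max 0 t differ by at most exp (- |t|) ([softplus_relu_dist]).  A
    Moebius transform adds at most 2 ^ #|V| such errors ([moebius_dist]),
    which is beaten by the exponential.  The free coefficient K_B absorbs the
    diverging constant K. *)

(** Far from its kink, the positive part [Num.max 0 t] is exponentially close
    to log (1 + exp t): for t < 0 both are near 0, and for t >= 0 the identity
    log (1 + exp t) = t + log (1 + exp (- t)) reduces to the same bound. *)
Lemma softplus_relu_dist (R : realType) (t : R) :
  `|ln (1 + expR t) - Num.max 0 t| <= expR (- `|t|).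
Proof.
have ln_bound (s : R) : 0 <= ln (1 + expR s) <= expR s.
  rewrite ln_ge0 ?lerDl ?expR_ge0 //= le_ln1Dx //.
  by rewrite (lt_trans _ (expR_gt0 s)) // ltrN10.
have [t_ge0|t_lt0] := leP 0 t.
  have -> : 1 + expR t = expR t * (1 + expR (- t)).
    by rewrite mulrDr mulr1 expRxMexpNx_1 addrC.
  rewrite lnM ?posrE ?addr_gt0 ?expR_gt0 // expRK addrC addKr.
  by have /andP[lo hi] := ln_bound (- t); rewrite !ger0_norm.
have /andP[lo hi] := ln_bound t.
by rewrite subr0 (ltr0_norm t_lt0) opprK ger0_norm.
Qed.

(** The sum is an expanded product over the points i of V, with one term for
    i \in A and one for i \notin A.  The two terms of a point add up to 1 if
    the point lies in both or neither of C and D; they cancel if it lies in C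
    only, and both are 0 if it lies in D only. *)
Lemma moebius_upset (R : comNzRingType) (V : finType) (C D : {set V}) :
  \sum_(A : {set V} | A \subset C) (-1) ^+ #|C :\: A| * (D \subset A)%:R
    = (C == D)%:R :> R.
Proof.
pose F i : R := (i \in C)%:R.
pose G i : R := (-1) ^+ (i \in C) * (i \notin D)%:R.
have FG i : F i + G i = ((i \in C) == (i \in D))%:R.
  by rewrite /F /G; case: (i \in C); case: (i \in D);
     rewrite ?expr1 ?expr0 ?mulr1 ?mulr0 ?addr0 ?add0r ?subrr.
transitivity (\prod_i (F i + G i)); last first.
  rewrite (eq_bigr _ (fun i _ => FG i)).
  have [->|neqCD] := eqVneq C D; first by rewrite big1 // => i _; rewrite eqxx.
  have [i neq_i] : exists i, (i \in C) != (i \in D).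
    apply/existsP; rewrite -negb_forall; apply: contra neqCD => /forallP eqCD.
    by apply/eqP/setP => i; apply/eqP.
  by rewrite (bigD1 i) //= (negbTE neq_i) mul0r.
rewrite bigA_distr [RHS](bigID (fun A : {set V} => A \subset C)) /=.
rewrite [X in _ + X]big1 ?addr0 => [|A /subsetPn[i iA iC]]; last first.
  by rewrite (bigD1 i) //= iA /F (negbTE iC) mul0r.
apply: eq_bigr => A sAC.
have [sDA|/subsetPn[i iD iA]] := boolP (D \subset A); last first.
  by rewrite mulr0 (bigD1 i) //= (negbTE iA) /G iD mulr0 mul0r.
rewrite mulr1 -prodr_const big_mkcond; apply: eq_bigr => i _ /=.
rewrite /F /G inE; have [iA|iA] /= := boolP (i \in A).
  by rewrite (subsetP sAC).
rewrite (contra (subsetP sDA i) iA) mulr1.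
by case: (i \in C).
Qed.

Lemma moebius_dist (R : numDomainType) (V : finType) (f g : {set V} -> R)
    (d : R) (C : {set V}) :
  (forall A, `|f A - g A| <= d) ->
  `|\sum_(A : {set V} | A \subset C) (-1) ^+ #|C :\: A| * f A
    - \sum_(A : {set V} | A \subset C) (-1) ^+ #|C :\: A| * g A|
    <= (2 ^ #|V|)%:R * d.
Proof.
move=> fg_dist; rewrite -sumrB.
have d_ge0 : 0 <= d := le_trans (normr_ge0 _) (fg_dist set0).
apply: le_trans (ler_norm_sum _ _ _) _.
have -> : (2 ^ #|V|)%:R * d = \sum_(A : {set V}) d.
  rewrite sumr_const mulr_natl -cardsT -card_powerset powersetT cardsT.
  by congr (_ *+ _).
rewrite [leRHS](bigID (fun A : {set V} => A \subset C)) /=.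
rewrite -[leLHS]addr0 lerD ?sumr_ge0 // ler_sum // => A _.
by rewrite -mulrBr normrM normrX normrN1 expr1n mul1r.
Qed.

(** Together with [gate_bias]: were a zero, the unit would be active exactly on
    the supersets of B, with margin K on both sides of the threshold; a
    perturbs this linearly. *)
Definition gate_weight (R : realDomainType) (V : finType) (B B' : {set V})
    (a : V -> R) (K : R) (i : V) : R :=
  if i \in B then K *+ 2 else if i \in B' then a i else 0.

Definition gate_bias (R : realDomainType) (V : finType) (B : {set V})
    (K : R) : R :=
  K - K *+ 2 *+ #|B|.

Definition gate_target (R : realDomainType) (V : finType) (B B' : {set V})
    (a : V -> R) (K : R) (A : {set V}) : R :=
  (B \subset A)%:R * K + \sum_(j in B') (B :|: [set j] \subset A)%:R * a j.

Lemma moebius_gate_target (R : realDomainType) (V : finType) (B B' C : {set V})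
    (a : V -> R) (K : R) :
  \sum_(A : {set V} | A \subset C)
      (-1) ^+ #|C :\: A| * gate_target B B' a K A
    = (C == B)%:R * K + \sum_(j in B') (C == B :|: [set j])%:R * a j.
Proof.
under eq_bigr do rewrite mulrDr mulrA mulr_sumr.
rewrite big_split /= -mulr_suml moebius_upset exchange_big /=; congr (_ + _).
apply: eq_bigr => j _; under eq_bigr do rewrite mulrA.
by rewrite -mulr_suml moebius_upset.
Qed.

Lemma gate_preactivation (R : realDomainType) (V : finType) (B B' A : {set V})
    (a : V -> R) (K : R) :
  B :&: B' = set0 ->
  \sum_(i in A) gate_weight B B' a K i + gate_bias B K
    = K - K *+ 2 *+ #|B :\: A| + \sum_(j in B' :&: A) a j.
Proof.
move=> disjBB'.
have -> : \sum_(i in A) gate_weight B B' a K i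
    = K *+ 2 *+ #|B :&: A| + \sum_(j in B' :&: A) a j.
  rewrite (bigID (mem B)) /=; congr (_ + _).
    rewrite (eq_bigr (fun=> K *+ 2)) => [|i /andP[_ iB]].
      rewrite sumr_const; congr (_ *+ _).
      by apply: eq_card => i; rewrite !inE andbC.
    by rewrite /gate_weight iB.
  rewrite (bigID (mem B')) /= [X in _ + X]big1 ?addr0; last first.
    move=> i /andP[/andP[_ iB] iB'].
    by rewrite /gate_weight (negbTE iB) (negbTE iB').
  apply: eq_big => [i|i /andP[/andP[_ iB] iB']].
    have := in_set0 i; rewrite -disjBB' !inE.
    by case: (i \in A); case: (i \in B); case: (i \in B').
  by rewrite /gate_weight (negbTE iB) iB'.
by rewrite /gate_bias -(cardsID A B) mulrnDr; lra.
Qed.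

(** The condition on K says that the weights on B', whose total effect is at
    most the sum of |a j|, can neither close an open gate nor open a closed one, and
    still leave a margin M. *)
Lemma gate_relu (R : realDomainType) (V : finType) (B B' A : {set V})
    (a : V -> R) (K M : R) :
  B :&: B' = set0 -> 0 <= M -> \sum_(j in B') `|a j| + M <= K ->
  let t := \sum_(i in A) gate_weight B B' a K i + gate_bias B K in
  Num.max 0 t = gate_target B B' a K A /\ M <= `|t|.
Proof.
move=> disjBB' M_ge0 le_K; rewrite /= gate_preactivation //.
have S_mask : \sum_(j in B' :&: A) a j = \sum_(j in B') (j \in A)%:R * a j.
  rewrite (eq_bigl (fun j => (j \in B') && (j \in A))) => [|j]; last first.
    by rewrite inE.
  rewrite big_mkcondr; apply: eq_bigr => j _.
  by case: (j \in A); rewrite ?mul1r ?mul0r.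
set N := \sum_(j in B') _ in le_K.
have K_ge0 : 0 <= K by apply: le_trans le_K; rewrite addr_ge0 // sumr_ge0.
have /ler_normlP[NS SN] : `|\sum_(j in B' :&: A) a j| <= N.
  rewrite S_mask; apply: le_trans (ler_norm_sum _ _ _) _.
  apply: ler_sum => j _.
  by rewrite normrM normr_nat ler_piMl // lern1 leq_b1.
have [sBA|nsBA] := boolP (B \subset A).
  have /eqP -> : B :\: A == set0 by rewrite setD_eq0.
  rewrite cards0 mulr0n subr0.
  have t_ge : M <= K + \sum_(j in B' :&: A) a j by lra.
  rewrite max_r ?ger0_norm ?(le_trans M_ge0) //; split=> //.
  rewrite /gate_target sBA mul1r S_mask; congr (_ + _).
  by apply: eq_bigr => j _; rewrite subUset sBA sub1set.
have B_missing : (0 < #|B :\: A|)%N by rewrite card_gt0 setD_eq0.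
(* A single missing element of B already costs 2 K. *)
have le_n : K *+ 2 <= K *+ 2 *+ #|B :\: A|.
  by rewrite -[leLHS]mulr1n ler_wpMn2l // mulrn_wge0.
set Q := K *+ 2 *+ _ in le_n *; set S := \sum_(j in _) _ in NS SN *.
have t_le : K - Q + S <= - M by lra.
split; last by rewrite ler0_norm; lra.
rewrite max_l; last by lra.
rewrite /gate_target (negbTE nsBA) mul0r add0r big1 // => j _.
by rewrite subUset (negbTE nsBA) mul0r.
Qed.

Lemma exists_scaled_expRN_le (R : realType) (n : nat) (eps : R) :
  0 < eps -> exists2 M : R, 0 <= M & n%:R * expR (- M) <= eps.
Proof.
move=> eps_gt0; exists (n%:R / eps); first by rewrite divr_ge0 // ltW.
rewrite expRN ler_pdivrMr ?expR_gt0 // mulrC -ler_pdivrMr //.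
by rewrite (le_trans _ (expR_ge1Dx _)) // lerDr.
Qed.

Theorem lemma5 (R : realType) (V : finType) (B B' : {set V})
    (disjBB' : B :&: B' = set0) (J : {set V} -> R) (eps : R)
    (eps_gt0 : 0 < eps) :
  exists (w : V -> R) (c : R),
    [/\ forall i : V, i \notin B :|: B' -> w i = 0,
        forall j : V, j \in B' ->
          `|softplus_coef w c (B :|: [set j]) - J (B :|: [set j])| <= eps
      & forall C : {set V}, C != B ->
          (forall j : V, j \in B' -> C != B :|: [set j]) ->
          `|softplus_coef w c C| <= eps].
Proof.
have [M M_ge0 M_eps] := exists_scaled_expRN_le (2 ^ #|V|) eps_gt0.
pose a j := J (B :|: [set j]); pose K := \sum_(j in B') `|a j| + M.
pose w := gate_weight B B' a K; pose c := gate_bias B K.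
exists w, c.
have coef_dist C : `|softplus_coef w c C
    - ((C == B)%:R * K + \sum_(j in B') (C == B :|: [set j])%:R * a j)| <= eps.
  rewrite -moebius_gate_target; apply: le_trans M_eps.
  apply: moebius_dist => A.
  have [<- le_M] := gate_relu A disjBB' M_ge0 (lexx K).
  by apply: le_trans (softplus_relu_dist _) _; rewrite ler_expR lerN2.
split=> [i|j jB'|C neqCB neqCj].
- by rewrite inE negb_or /w /gate_weight => /andP[/negbTE-> /negbTE->].
- have notinB i : i \in B' -> i \notin B.
    move=> iB'; apply/negP => iB.
    by have := in_set0 i; rewrite -disjBB' inE iB iB'.
  have := coef_dist (B :|: [set j]); rewrite (bigD1 j) //= eqxx mul1r.
  rewrite big1 ?addr0 => [|i /andP[_ neq_ij]].
    suff /negbTE-> : B :|: [set j] != B by rewrite mul0r add0r.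
    by apply: contraNneq (notinB j jB') => <-; rewrite !inE eqxx orbT.
  suff /negbTE-> : B :|: [set j] != B :|: [set i] by rewrite mul0r.
  apply/eqP => /setP/(_ j).
  by rewrite !inE eqxx orbT (negbTE (notinB j jB')) eq_sym (negbTE neq_ij).
have := coef_dist C; rewrite (negbTE neqCB) mul0r add0r big1 ?subr0 // => j jB'.
by rewrite (negbTE (neqCj j jB')) mul0r.
Qed.
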